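(* Let $2\le k\le 2n-2$. The characteristic numbers of a regular tuple $(\mathbb R^{2n},\omega,S_1^k\cup S_2^k)_0$ are its invariants: if two regular tuples of this form are equivalent then their characteristic numbers are the same.
   Context: A fixed category, smooth or real-analytic, is used. $[\,\cdot\,]$ denotes the integer part. A $k$-dimensional submanifold (or subspace) of a symplectic manifold (or symplectic vector space) is symplectic (if $k$ is even), resp. quasi-symplectic (if $k$ is odd), if the restriction of the symplectic form to it has maximal possible rank $2[k/2]$. A tuple $(\mathbb R^{2n},\omega,S_1^k\cup S_2^k)_0$ consists of the germs at $0$ of a symplectic form $\omega$ and of two $k$-dimensional symplectic or quasi-symplectic submanifolds $S_1^k,S_2^k$ containing $0$. Two such tuples are equivalent if there is a local diffeomorphism of $\mathbb R^{2n}$, fixing $0$, which brings $\widetilde\omega$ to $\omega$ (by pullback) and $S_1^k\cup S_2^k$ to $\widetilde S_1^k\cup\widetilde S_2^k$. Linearization. The linearization of the tuple at $0$ is the linear tuple $(W^{2n},\sigma,U_1^k\cup U_2^k)$ with $W^{2n}=T_0\mathbb R^{2n}$, $\sigma=\omega|_{W^{2n}}$, $U_i^k=T_0S_i^k$. Regularity. A linear tuple $(W^{2n},\sigma,U_1^k\cup U_2^k)$ ($\sigma$ a symplectic form on the $2n$-dimensional vector space $W^{2n}$, $U_i^k$ subspaces of dimension $k$) is regular if: (1) $U_1^k,U_2^k$ are symplectic or quasi-symplectic, and $U_1^k\cap U_2^k=\{0\}$ for $k\le n$, $U_1^k+U_2^k=W^{2n}$ for $k>n$; (2) for $k\le n$,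 $\sigma|_{U_1^k+U_2^k}$ has maximal rank $2k$; for $k>n$, $\sigma|_{U_1^k\cap U_2^k}$ has maximal rank $2(k-n)$; (3) the skew-orthogonal complement of $U_1^k$ in $(W^{2n},\sigma)$ is transversal to $U_2^k$; (4) if $k$ is odd, then, with $\ell_i=\ker\sigma|_{U_i^k}$ (two different lines), $\sigma$ does not annihilate the plane $\ell_1+\ell_2$. A tuple of germs is regular if its linearization at $0$ is regular. Reduced linear tuple. Let $s=\min([k/2],[(2n-k)/2])$ and let $^\perp$ be the skew-orthogonal complement in $(W^{2n},\sigma)$. For $k$ even set $\widehat W^{4s}=U_1^k+U_2^k$ if $k\le n$ and $\widehat W^{4s}=(U_1^k\cap U_2^k)^\perp$ if $k>n$; for $k$ odd set $\widehat W^{4s}=(U_1^k+U_2^k)\cap(\ell_1+\ell_2)^\perp$ if $k\le n$ and $\widehat W^{4s}=(U_1^k\cap U_2^k)^\perp\cap(\ell_1+\ell_2)^\perp$ if $k>n$. Set $\widehat\sigma=\sigma|_{\widehat W^{4s}}$, $\widehat U_i^{2s}=U_i^k\cap\widehat W^{4s}$. For a regular tuple, $\dim\widehat W^{4s}=4s$, $\dim\widehat U_i^{2s}=2s$, $\widehat\sigma$ is symplectic and the reduced tuple is regular. Characteristic numbers. Let $\pi_i:\widehat W^{4s}\to\widehat U_i^{2s}$ be the projection associated with $\widehat W^{4s}=\widehat U_i^{2s}\oplus(\widehat U_i^{2s})^\perp$ (here $^\perp$ is taken in $(\widehat W^{4s},\widehat\sigma)$). The operators $L_1=\pi_1\circ(\pi_2|_{\widehat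 U_1^{2s}})$ on $\widehat U_1^{2s}$ and $L_2=\pi_2\circ(\pi_1|_{\widehat U_2^{2s}})$ on $\widehat U_2^{2s}$ are conjugate. The characteristic numbers of the tuple are the eigenvalues (real and complex) of $L_1$ or $L_2$, counted with multiplicity. *)

(* Defs.v *)
From mathcomp Require Import all_boot all_order all_algebra.
From mathcomp Require Import complex.
From mathcomp Require Import all_classical all_reals all_analysis.

Set Implicit Arguments.
Unset Strict Implicit.
Unset Printing Implicit Defensive.

Import Order.TTheory GRing.Theory Num.Theory.
Import numFieldNormedType.Exports.

Local Open Scope classical_set_scope.
Local Open Scope ring_scope.

(* Vectors are row vectors, a subspace is the row space of a matrix, and a
   bilinear form is given by its Gram matrix in the standard basis.  Germs at
   a point are given by representatives, all conditions on them being imposed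
   only near that point. *)

Section Regularity.
Context {R : realType} {V W : normedModType R}.

Definition iter_derive (f : V -> W) (l : seq V) : V -> W :=
  foldr (fun v (g : V -> W) (x : V) => 'D_v g x) f l.

(* C^oo near a: all iterated directional derivatives exist and are Frechet
   differentiable on one common neighbourhood of a. *)
Definition smooth_at (f : V -> W) (a : V) : Prop :=
  \forall x \near a, forall l : seq V, differentiable (iter_derive f l) x.

(* Real-analytic near a: C^oo, and at every point near a the Taylor series,
   whose degree d term in the increment h is D^d f(x)[h, ..., h] / d!,
   converges to f on a neighbourhood of that point. *)
Definition analytic_at (f : V -> W) (a : V) : Prop :=
  smooth_at f a /\
  \forall x \near a, \forall h \near (0 : V),
    series (fun d => (d`!%:R : R)^-1 *: iter_derive f (nseq d h) x) @ \oo
      --> f (x + h).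

End Regularity.

Variant category := Smooth | Analytic.

Definition class_at {R : realType} {V W : normedModType R} (c : category)
    (f : V -> W) (a : V) : Prop :=
  match c with Smooth => smooth_at f a | Analytic => analytic_at f a end.

Section Linear.
Context {R : realType} {m : nat}.
Implicit Types (sigma U : 'M[R]_m).

Definition bilin sigma (u v : 'rV[R]_m) : R := (u *m sigma *m v^T) 0 0.

Definition symplectic_form sigma : Prop :=
  sigma^T = - sigma /\ sigma \in unitmx.

Definition rank_on sigma U : nat := \rank (U *m sigma *m U^T).

Definition max_rank sigma U : Prop := rank_on sigma U = (\rank U)./2.*2.

Definition skew_orth sigma U : 'M[R]_m := kermx (sigma *m U^T).

Definition ker_on sigma U : 'M[R]_m := (U :&: skew_orth sigma U)%MS.

End Linear.

Record linear_tuple (R : realType) (n : nat) := LinearTuple {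
  lform : 'M[R]_n.*2;
  sub1 : 'M[R]_n.*2;
  sub2 : 'M[R]_n.*2 }.

Section LinearTuple.
Context {R : realType} {n : nat}.
Variables (k : nat) (T : linear_tuple R n).
Local Notation sigma := (lform T).
Local Notation U1 := (sub1 T).
Local Notation U2 := (sub2 T).

Definition is_linear_tuple : Prop :=
  [/\ symplectic_form sigma, \rank U1 = k & \rank U2 = k].

Definition ker_plane : 'M[R]_n.*2 := (ker_on sigma U1 + ker_on sigma U2)%MS.

Definition regular_linear : Prop :=
  [/\ is_linear_tuple,
      [/\ max_rank sigma U1, max_rank sigma U2
        & if (k <= n)%N then (U1 :&: U2)%MS = 0 else row_full (U1 + U2)%MS],
      if (k <= n)%N then rank_on sigma (U1 + U2)%MS = k.*2
      else rank_on sigma (U1 :&: U2)%MS = (k - n).*2,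
      row_full (skew_orth sigma U1 + U2)%MS
    & odd k -> ker_plane *m sigma *m ker_plane^T <> 0].

Definition reduced_space : 'M[R]_n.*2 :=
  let W := if (k <= n)%N then (U1 + U2)%MS
           else skew_orth sigma (U1 :&: U2)%MS in
  if odd k then (W :&: skew_orth sigma ker_plane)%MS else W.

Definition reduced_sub (U : 'M[R]_n.*2) : 'M[R]_n.*2 :=
  (U :&: reduced_space)%MS.

Definition reduced_proj (U : 'M[R]_n.*2) : 'M[R]_n.*2 :=
  proj_mx (reduced_sub U)
          (skew_orth sigma (reduced_sub U) :&: reduced_space)%MS.

(* Operators act on row vectors from the right, so pi_1 o pi_2 is the matrix
   pi_2 *m pi_1. *)
Definition char_operator : 'M[R]_(\rank (reduced_sub U1)) :=
  restrictmx (reduced_sub U1) (reduced_proj U2 *m reduced_proj U1).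

(* The complex eigenvalues listed with algebraic multiplicity, in an
   unspecified order. *)
Definition char_numbers_linear : seq R[i] :=
  sval (closed_field_poly_normal
          (map_poly (real_complex R) (char_poly char_operator))).

End LinearTuple.

Section Germs.
Context {R : realType} {m : nat}.
Local Notation E := 'rV[R]_m.

Definition local_diffeo (c : category) (Phi : E -> E) : Prop :=
  [/\ Phi 0 = 0, class_at c Phi 0
    & exists Psi : E -> E,
      [/\ Psi 0 = 0, class_at c Psi 0,
          \forall x \near (0 : E), Psi (Phi x) = x
        & \forall y \near (0 : E), Phi (Psi y) = y]].

(* S is near 0 the preimage of R^k x {0} under a chart centred at 0; in
   particular 0 belongs to S. *)
Definition submanifold_germ (c : category) (k : nat) (S : set E) : Prop :=
  exists2 phi : E -> E, local_diffeo c phi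
    & \forall x \near (0 : E),
        S x <-> forall i : 'I_m, (k <= i)%N -> phi x 0 i = 0.

Definition tangent_vector (S : set E) (x v : E) : Prop :=
  exists gamma : R -> E,
    [/\ smooth_at gamma 0, gamma 0 = x,
        \forall t \near (0 : R), S (gamma t)
      & 'D_1 gamma 0 = v].

(* A matrix whose row space is the set of tangent vectors (the default value 0
   is irrelevant when S is a submanifold near x). *)
Definition tangent_space (S : set E) (x : E) : 'M[R]_m :=
  xget 0 [set U : 'M[R]_m | forall v : E,
            (v <= U)%MS <-> tangent_vector S x v].

Definition closed_form_at0 (omega : E -> 'M[R]_m) : Prop :=
  \forall x \near (0 : E), forall u v w : E,
    'D_u (fun y => bilin (omega y) v w) x
    + 'D_v (fun y => bilin (omega y) w u) x
    + 'D_w (fun y => bilin (omega y) u v) x = 0.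

Definition symplectic_germ (c : category) (omega : E -> 'M[R]_m) : Prop :=
  [/\ class_at c omega 0,
      \forall x \near (0 : E), symplectic_form (omega x)
    & closed_form_at0 omega].

(* Symplectic (k even) or quasi-symplectic (k odd) submanifold. *)
Definition symplectic_submanifold_germ (c : category) (k : nat)
    (omega : E -> 'M[R]_m) (S : set E) : Prop :=
  submanifold_germ c k S /\
  \forall x \near (0 : E), S x -> max_rank (omega x) (tangent_space S x).

End Germs.

Record germ_tuple (R : realType) (n : nat) := GermTuple {
  omega : 'rV[R]_n.*2 -> 'M[R]_n.*2;
  S1 : set 'rV[R]_n.*2;
  S2 : set 'rV[R]_n.*2 }.

Section GermTuple.
Context {R : realType} {n : nat}.
Implicit Types T : germ_tuple R n.
Local Notation E := 'rV[R]_n.*2.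

Definition is_germ_tuple (c : category) (k : nat) T : Prop :=
  [/\ symplectic_germ c (omega T),
      symplectic_submanifold_germ c k (omega T) (S1 T)
    & symplectic_submanifold_germ c k (omega T) (S2 T)].

Definition linearization T : linear_tuple R n :=
  LinearTuple (omega T 0) (tangent_space (S1 T) 0) (tangent_space (S2 T) 0).

Definition regular (c : category) (k : nat) T : Prop :=
  is_germ_tuple c k T /\ regular_linear k (linearization T).

Definition char_numbers (k : nat) T : seq R[i] :=
  char_numbers_linear k (linearization T).

Definition equivalent (c : category) T T' : Prop :=
  exists Phi : E -> E,
    [/\ local_diffeo c Phi,
        \forall x \near (0 : E), forall u v : E,
          bilin (omega T' (Phi x)) ('d Phi x u) ('d Phi x v)
          = bilin (omega T x) u v
      & \forall x \near (0 : E),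
          (S1 T `|` S2 T) x <-> (S1 T' `|` S2 T') (Phi x)].

End GermTuple.

(* Main.v *)
Require Import Defs.
From mathcomp Require Import all_boot all_order all_algebra.
From mathcomp Require Import complex.
From mathcomp Require Import all_classical all_reals all_analysis.
From mathcomp Require Import zify.

Set Implicit Arguments.
Unset Strict Implicit.
Unset Printing Implicit Defensive.

Import Order.TTheory GRing.Theory Num.Theory.
Import numFieldNormedType.Exports.

Local Open Scope classical_set_scope.
Local Open Scope ring_scope.

(** Let Phi be an equivalence and A its Jacobian matrix at 0, which acts on row
    vectors from the right.  The argument has two independent halves.

    Differential half.  A is a linear isometry from the first symplectic form
    at 0 to the second, and it maps the unordered pair of tangent spaces of
    the first tuple onto that of the second.  Indeed, let S be straightened by
    a chart phi.  The tangent vectors of S at 0 lie in the subspace K on which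
    the last 2n - k coordinates of the differential of phi vanish, and they
    fill K because both spaces have dimension k, K as phi is a chart and the
    tangent space by regularity ([tangent_space_straight]).  Let gamma be a
    curve in S_1 with velocity v, and let phi'_i and phi''_j be any two of
    these last coordinates, for charts phi' and phi'' of S_1' and S_2'.  As
    Phi o gamma stays in the union of S_1' and S_2',
    the product of phi'_i and phi''_j vanishes along it; both factors vanish
    at 0, so the product of their derivatives along the image w of v vanishes
    ([mul_eq0_near_curve]).  Hence w is tangent to S_1' or to S_2', and
    as a subspace contained in the union of two subspaces is contained in one
    of them, A maps each tangent space onto one of the two tangent spaces
    ([tangent_union]).  The two images are different because regularity makes
    the two tangent spaces different when 2 <= k <= 2n - 2
    ([equivalent_isometric]).

    Linear half.  Regularity implies that the form is nondegenerate on both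
    reduced subspaces and that these have the same dimension
    ([regular_reducible]); hence the skew-orthogonal projections are
    characterized by the form, and an isometry conjugates the operators L_1
    ([char_poly_operator_map]).  If A exchanges the two subspaces, one uses in
    addition that L_1 and L_2 are the products X Y and Y X of the same two
    square matrices, which have the same characteristic polynomial
    ([char_poly_operator_swap]). *)

(** * Characteristic polynomials *)

(** Both sides are the determinant of the block matrix with rows (x, A) and
    (B, 1), multiplied by x^n. *)
Lemma char_poly_mulC (R : comNzRingType) (m n : nat) (A : 'M[R]_(m, n))
    (B : 'M[R]_(n, m)) :
  'X^n * char_poly (A *m B) = 'X^m * char_poly (B *m A).
Proof.
rewrite /char_poly /char_poly_mx !map_mxM.
set a := map_mx _ A; set b := map_mx _ B.
pose N := block_mx 'X%:M a b 1%:M.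
have <- : \det N = \det ('X%:M - a *m b).
  transitivity (\det (N *m block_mx 1%:M 0 (- b) 1%:M)).
    by rewrite det_mulmx det_lblock !det1 !mulr1.
  rewrite mulmx_block !(mulmx1, mul1mx, mulmx0, add0r) mulmxN subrr.
  by rewrite det_ublock det1 mulr1.
rewrite -!det_scalar -(@det_ublock _ _ _ 'X%:M a).
rewrite -[\det 'X%:M as X in X * _]mul1r -[in LHS](det1 _ m).
rewrite -(@det_lblock _ _ _ 1%:M (- b)) -det_mulmx mulmx_block.
rewrite !(mulmx1, mul1mx, mul0mx, addr0) mulNmx mul_scalar_mx mul_mx_scalar.
by rewrite addNr mulNmx addrC.
Qed.

Lemma char_poly_simmx (F : fieldType) (n : nat) (Q L M : 'M[F]_n) :
  Q \in unitmx -> Q *m L = M *m Q -> char_poly L = char_poly M.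
Proof.
move=> uQ QL; have nz : \det (map_mx polyC Q) != 0.
  by rewrite det_map_mx polyC_eq0 -unitfE -unitmxE.
apply: (mulfI nz); rewrite -det_mulmx [RHS]mulrC -det_mulmx; congr (\det _).
by rewrite mulmxBr mulmxBl -!map_mxM QL scalar_mxC.
Qed.

(** The restriction of f to a stable subspace V may be computed in any basis B
    of V; stability follows from the equation for M. *)
Lemma char_poly_restrictmx (F : fieldType) (m r : nat) (V f : 'M[F]_m)
    (B : 'M[F]_(r, m)) (M : 'M[F]_r) :
  row_free B -> (B :=: V)%MS -> B *m f = M *m B ->
  char_poly (restrictmx V f) = char_poly M.
Proof.
move=> fB BV Bf.
have er : r = \rank V by rewrite -BV; apply/esym/eqP.
subst r; pose C := row_base V; have fC : row_free C := row_base_free V.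
have /submxP[Q BQ] : (B <= C)%MS by rewrite BV eq_row_base.
have uQ : Q \in unitmx by rewrite -row_free_unit /row_free -(mxrankMfree Q fC) -BQ.
have Vf : C *m f = restrictmx V f *m C.
  rewrite mulmxKpV // eq_row_base -BV.
  by rewrite (eqmxMr f (eqmx_trans (eq_row_base V) (eqmx_sym BV))) Bf submxMl.
apply: (char_poly_simmx uQ); apply: (row_free_inj fC).
by rewrite /= -mulmxA -Vf mulmxA -BQ Bf BQ mulmxA.
Qed.

(** * Skew-orthogonality *)

Section Skew.
Variables (R : realType) (m : nat) (sigma : 'M[R]_m).
Hypothesis sigmaN : sigma^T = - sigma.

Lemma sub_skew_orth p (X : 'M[R]_(p, m)) (U : 'M[R]_m) :
  (X <= skew_orth sigma U)%MS = (X *m sigma *m U^T == 0).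
Proof. by rewrite sub_kermx mulmxA. Qed.

Lemma orth_sub p q p' q' (X : 'M[R]_(p, m)) (Y : 'M[R]_(q, m)) (X' : 'M[R]_(p', m))
    (Y' : 'M[R]_(q', m)) : (X <= X')%MS -> (Y <= Y')%MS ->
  X' *m sigma *m Y'^T = 0 -> X *m sigma *m Y^T = 0.
Proof.
move=> /submxP[D ->] /submxP[E ->]; rewrite trmx_mul -!mulmxA => /(congr1 (mulmx D)).
by rewrite mulmx0 !mulmxA => ->; rewrite mul0mx.
Qed.

Lemma trmx_pairing p q (X : 'M[R]_(p, m)) (Y : 'M[R]_(q, m)) :
  (X *m sigma *m Y^T)^T = - (Y *m sigma *m X^T).
Proof. by rewrite !trmx_mul trmxK sigmaN mulNmx mulmxN mulmxA. Qed.

Lemma orth_sym p q (X : 'M[R]_(p, m)) (Y : 'M[R]_(q, m)) :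
  X *m sigma *m Y^T = 0 -> Y *m sigma *m X^T = 0.
Proof. by move=> h; apply: oppr_inj; rewrite -trmx_pairing h trmx0 oppr0. Qed.

Lemma rank_pairingC p q (X : 'M[R]_(p, m)) (Y : 'M[R]_(q, m)) :
  \rank (X *m sigma *m Y^T) = \rank (Y *m sigma *m X^T).
Proof. by rewrite -mxrank_tr trmx_pairing mxrank_opp. Qed.

Lemma skew_orthS (U V : 'M[R]_m) : (U <= V)%MS ->
  (skew_orth sigma V <= skew_orth sigma U)%MS.
Proof.
move=> UV; rewrite sub_skew_orth; apply/eqP/(orth_sub (submx_refl _) UV)/eqP.
by rewrite -sub_skew_orth.
Qed.

Lemma orthD p (X : 'M[R]_(p, m)) (C D : 'M[R]_m) :
  X *m sigma *m C^T = 0 -> X *m sigma *m D^T = 0 ->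
  X *m sigma *m ((C + D)%MS)^T = 0.
Proof.
move=> /orth_sym/eqP hC /orth_sym/eqP hD; apply: orth_sym; apply/eqP.
by rewrite -mulmxA -sub_kermx addsmx_sub !sub_kermx !mulmxA hC.
Qed.

Lemma rank_cap_skew_orth (U Z : 'M[R]_m) :
  (\rank (U *m sigma *m Z^T) + \rank (U :&: skew_orth sigma Z)%MS)%N = \rank U.
Proof. by rewrite -(mxrank_mul_ker U (sigma *m Z^T)) mulmxA. Qed.

(** If C, a subspace of U, has the same image as U in the dual of Z, then U is
    spanned by C and the part of U skew-orthogonal to Z. *)
Lemma pairing_decomp (C U Z : 'M[R]_m) : (C <= U)%MS ->
  \rank (C *m sigma *m Z^T) = \rank (U *m sigma *m Z^T) ->
  (U <= C + (U :&: skew_orth sigma Z))%MS.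
Proof.
move=> CU; rewrite -!mulmxA; set f := sigma *m Z^T => rk.
have /submxP[D eD] : (U *m f <= C *m f)%MS.
  by rewrite -(mxrank_leqif_sup (submxMr f CU)).2 rk.
rewrite -[X in (X <= _)%MS](addrNK (D *m C)) addrC addmx_sub_adds ?submxMl //.
rewrite sub_capmx addmx_sub ?eqmx_opp ?(submx_trans (submxMl _ _) CU) //=.
by rewrite sub_kermx mulmxBl eD mulmxA subrr.
Qed.

(** Cutting U by the skew-orthogonal of Z does not enlarge the kernel of the
    form, provided that C, which spans U together with the cut, is orthogonal
    to the cut. *)
Lemma ker_on_cap (C U Z : 'M[R]_m) : (C <= U)%MS ->
  \rank (C *m sigma *m Z^T) = \rank (U *m sigma *m Z^T) ->
  (U :&: skew_orth sigma Z)%MS *m sigma *m C^T = 0 ->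
  (ker_on sigma (U :&: skew_orth sigma Z) <= ker_on sigma U)%MS.
Proof.
move=> CU rk VC; set V := (U :&: _)%MS in VC *.
have XV : (ker_on sigma V <= V)%MS := capmxSl _ _.
rewrite sub_capmx (submx_trans XV (capmxSl _ _)) /= sub_skew_orth.
apply/eqP/(orth_sub (submx_refl _) (pairing_decomp CU rk))/orthD.
  exact: orth_sub XV (submx_refl _) VC.
by apply/eqP; rewrite -sub_skew_orth capmxSr.
Qed.

Lemma rank_on_nondeg (V : 'M[R]_m) :
  ker_on sigma V = 0 <-> rank_on sigma V = \rank V.
Proof.
rewrite -(rank_cap_skew_orth V V) /rank_on -/(ker_on sigma V).
split=> [->|/eqP]; first by rewrite mxrank0 addn0.
by rewrite -{1}[\rank _]addn0 eqn_add2l eq_sym mxrank_eq0 => /eqP.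
Qed.

(** The projection onto a nondegenerate V along its skew-orthogonal complement in
    W; by [nondeg_inj] these two properties determine its values on W. *)
Lemma skew_projP (W V : 'M[R]_m) p (u : 'M[R]_(p, m)) :
  ker_on sigma V = 0 -> (V <= W)%MS -> (u <= W)%MS ->
  let pi := proj_mx V (skew_orth sigma V :&: W)%MS in
  (u *m pi <= V)%MS /\ (u - u *m pi) *m sigma *m V^T = 0.
Proof.
move=> nd VW uW pi; split; first exact: proj_mx_sub.
apply/eqP; rewrite -sub_skew_orth.
apply: submx_trans (capmxSl _ W); apply: proj_mx_compl_sub.
apply: (submx_trans uW); rewrite capmxC; apply: pairing_decomp => //.
apply/eqP; rewrite eqn_leq; apply/andP; split.
  by rewrite -!mulmxA mxrankS // submxMr.
have /rank_on_nondeg := nd; rewrite /rank_on => ->.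
by rewrite -(mxrank_tr V) -mulmxA mulmxA mxrankM_maxr.
Qed.

Lemma nondeg_inj (V : 'M[R]_m) p (a b : 'M[R]_(p, m)) : ker_on sigma V = 0 ->
  (a <= V)%MS -> (b <= V)%MS -> (a - b) *m sigma *m V^T = 0 -> a = b.
Proof.
move=> nd aV bV /eqP; rewrite -sub_skew_orth => h.
apply/eqP; rewrite -subr_eq0 -submx0 -nd sub_capmx h.
by rewrite addmx_sub // eqmx_opp.
Qed.

End Skew.

(** * Linear isometries *)

Section Isometry.
Variables (R : realType) (m : nat) (sigma sigma' A : 'M[R]_m).
Hypotheses (uA : A \in unitmx) (isoA : A *m sigma' *m A^T = sigma).

Let fA : row_free A. Proof. by rewrite row_free_unit. Qed.

Lemma pairing_map p q (X : 'M[R]_(p, m)) (Y : 'M[R]_(q, m)) :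
  (X *m A) *m sigma' *m (Y *m A)^T = X *m sigma *m Y^T.
Proof. by rewrite trmx_mul -isoA !mulmxA. Qed.

Lemma skew_orth_map (U U' : 'M[R]_m) : (U *m A :=: U')%MS ->
  (skew_orth sigma U *m A :=: skew_orth sigma' U')%MS.
Proof.
move=> UU'; apply/eqmxP/andP; split.
  rewrite sub_skew_orth; apply/eqP.
  have /eqmxP/andP[_ U'UA] := UU'.
  apply: (orth_sub (submx_refl _) U'UA).
  by rewrite pairing_map; apply/eqP; rewrite -sub_skew_orth.
rewrite -[X in (X <= _)%MS](mulmxKV uA) submxMfree // sub_skew_orth.
rewrite -pairing_map mulmxKV //; apply/eqP.
have /eqmxP/andP[UAU' _] := UU'; apply: (orth_sub (submx_refl _) UAU').
by apply/eqP; rewrite -sub_skew_orth.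
Qed.

Lemma capmx_map (U V U' V' : 'M[R]_m) : (U *m A :=: U')%MS ->
  (V *m A :=: V')%MS -> ((U :&: V)%MS *m A :=: U' :&: V')%MS.
Proof.
move=> UU' VV'; apply/eqmxP/andP; split.
  by apply: (submx_trans (capmxMr _ _ _)); rewrite (cap_eqmx UU' VV').
rewrite -[X in (X <= _)%MS](mulmxKV uA) submxMfree // sub_capmx.
by rewrite -(submxMfree _ U fA) -(submxMfree _ V fA) mulmxKV // UU' VV' capmxSl capmxSr.
Qed.

Lemma addsmx_map (U V U' V' : 'M[R]_m) : (U *m A :=: U')%MS ->
  (V *m A :=: V')%MS -> ((U + V)%MS *m A :=: U' + V')%MS.
Proof. by move=> UU' VV'; apply: eqmx_trans (addsmxMr _ _ _) (adds_eqmx UU' VV'). Qed.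

Lemma skew_proj_map (W V W' V' : 'M[R]_m) p (u : 'M[R]_(p, m)) :
  (W *m A :=: W')%MS -> (V *m A :=: V')%MS ->
  ker_on sigma V = 0 -> ker_on sigma' V' = 0 ->
  (V <= W)%MS -> (u <= W)%MS ->
  u *m proj_mx V (skew_orth sigma V :&: W)%MS *m A
  = u *m A *m proj_mx V' (skew_orth sigma' V' :&: W')%MS.
Proof.
move=> WW' VV' nd nd' VW uW.
have [piV pi_orth] := skew_projP nd VW uW.
have V'W' : (V' <= W')%MS by rewrite -VV' -WW' submxMr.
have uAW' : (u *m A <= W')%MS by rewrite -WW' submxMr.
have [piV' pi_orth'] := skew_projP nd' V'W' uAW'.
apply: (nondeg_inj nd') => //; first by rewrite -VV' submxMr.
set a := u *m _ in piV pi_orth *; set b := u *m A *m _ in piV' pi_orth' *.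
have eq_aA : (u - a) *m A *m sigma' *m V'^T = 0.
  have /eqmxP/andP[_ V'VA] := VV'.
  by apply: (orth_sub (submx_refl _) V'VA); rewrite pairing_map.
have -> : a *m A - b = (u *m A - b) - (u - a) *m A.
  by rewrite mulmxBl opprB [RHS]addrC addrA subrK.
move: pi_orth' eq_aA; move: (u *m A - b) ((u - a) *m A) => X Y hX hY.
by rewrite !mulmxBl hX hY subr0.
Qed.

End Isometry.

(** * Invariance of the characteristic polynomial *)

Section Tuples.
Context {R : realType} {n : nat}.
Implicit Types (k : nat) (T : linear_tuple R n).

(** The tuple with its two subspaces exchanged. *)
Definition swap T : linear_tuple R n := LinearTuple (lform T) (sub2 T) (sub1 T).

(** A carries the form and the two subspaces, in this order, of T to those of
    T'. *)
Definition isometric T T' (A : 'M[R]_n.*2) : Prop :=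
  [/\ A \in unitmx, A *m lform T' *m A^T = lform T,
      (sub1 T *m A :=: sub1 T')%MS & (sub2 T *m A :=: sub2 T')%MS].

(** The two reduced subspaces are nondegenerate and have the same dimension:
    all that the theory of the characteristic operator needs. *)
Definition reducible k T : Prop :=
  [/\ ker_on (lform T) (reduced_sub k T (sub1 T)) = 0,
      ker_on (lform T) (reduced_sub k T (sub2 T)) = 0
    & \rank (reduced_sub k T (sub1 T)) = \rank (reduced_sub k T (sub2 T))].

Lemma reduced_space_swap k T : reduced_space k (swap T) = reduced_space k T.
Proof.
rewrite /reduced_space /ker_plane /=.
rewrite [(sub2 T + _)%MS]addsmxC [(sub2 T :&: _)%MS]capmxC.
by rewrite [(ker_on _ (sub2 T) + _)%MS]addsmxC.
Qed.

Lemma reduced_space_map k T T' A : isometric T T' A ->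
  (reduced_space k T *m A :=: reduced_space k T')%MS.
Proof.
case=> uA isoA A1 A2.
have kerA U U' (UU' : (U *m A :=: U')%MS) :
    (ker_on (lform T) U *m A :=: ker_on (lform T') U')%MS.
  exact/(capmx_map uA UU')/skew_orth_map.
rewrite /reduced_space; case: ifP => _; case: ifP => _.
- apply: capmx_map => //; first exact: addsmx_map.
  by apply/skew_orth_map/addsmx_map => //; exact: kerA.
- apply: capmx_map => //; first by apply/skew_orth_map/capmx_map.
  by apply/skew_orth_map/addsmx_map => //; exact: kerA.
- exact: addsmx_map.
- by apply/skew_orth_map/capmx_map.
Qed.

Lemma char_poly_operator_map k T T' A : reducible k T -> reducible k T' ->
  isometric T T' A ->
  char_poly (char_operator k T) = char_poly (char_operator k T').
Proof.
move=> [nd1 nd2 _] [nd1' nd2' _] isoTT'.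
have WW' := reduced_space_map k isoTT'; case: isoTT' => uA isoA A1 A2.
set W := reduced_space k T in WW'; set W' := reduced_space k T' in WW'.
have V1 : (reduced_sub k T (sub1 T) *m A :=: reduced_sub k T' (sub1 T'))%MS.
  exact: capmx_map.
have V2 : (reduced_sub k T (sub2 T) *m A :=: reduced_sub k T' (sub2 T'))%MS.
  exact: capmx_map.
have sV1 : (reduced_sub k T (sub1 T) <= W)%MS := capmxSr _ _.
have sV2 : (reduced_sub k T (sub2 T) <= W)%MS := capmxSr _ _.
rewrite /char_operator; set f := _ *m _; set f' := _ *m _.
set B := row_base (reduced_sub k T (sub1 T)).
have BV : (B :=: reduced_sub k T (sub1 T))%MS := eq_row_base _.
have BW : (B <= W)%MS by rewrite BV.
have fB : B *m f = restrictmx (reduced_sub k T (sub1 T)) f *m B.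
  by rewrite mulmxKpV // BV mulmxA proj_mx_sub.
symmetry; apply: (@char_poly_restrictmx _ _ _ _ _ (B *m A)).
- by rewrite /row_free mxrankMfree ?row_free_unit //; exact: row_base_free.
- exact: eqmx_trans (eqmxMr A BV) V1.
have step2 : B *m reduced_proj k T (sub2 T) *m A
    = B *m A *m reduced_proj k T' (sub2 T').
  exact: skew_proj_map WW' V2 nd2 nd2' sV2 BW.
have step1 : B *m reduced_proj k T (sub2 T) *m reduced_proj k T (sub1 T) *m A
    = B *m reduced_proj k T (sub2 T) *m A *m reduced_proj k T' (sub1 T').
  apply: skew_proj_map WW' V1 nd1 nd1' sV1 _ => //.
  exact: submx_trans (proj_mx_sub _ _ _) sV2.
by rewrite [RHS]mulmxA -fB /f' /f [LHS]mulmxA -step2 -step1 !mulmxA.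
Qed.

Lemma char_poly_operator_swap k T : reducible k T ->
  char_poly (char_operator k (swap T)) = char_poly (char_operator k T).
Proof.
case=> _ _ rk.
have subE U : reduced_sub k (swap T) U = reduced_sub k T U.
  by rewrite /reduced_sub reduced_space_swap.
have projE U : reduced_proj k (swap T) U = reduced_proj k T U.
  by rewrite /reduced_proj !subE reduced_space_swap.
set V1 := reduced_sub k T (sub1 T) in rk; set V2 := reduced_sub k T (sub2 T) in rk.
set p1 := reduced_proj k T (sub1 T); set p2 := reduced_proj k T (sub2 T).
have B1 := eq_row_base V1; have B2 := eq_row_base V2.
have /submxP[X eX] : (row_base V1 *m p2 <= row_base V2)%MS by rewrite B2 proj_mx_sub.
have /submxP[Y eY] : (row_base V2 *m p1 <= row_base V1)%MS by rewrite B1 proj_mx_sub.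
have -> : char_poly (char_operator k T) = char_poly (X *m Y).
  apply: char_poly_restrictmx B1 _; first exact: row_base_free.
  by rewrite -/p1 -/p2 mulmxA eX -mulmxA eY mulmxA.
have -> : char_poly (char_operator k (swap T)) = char_poly (Y *m X).
  rewrite /char_operator !projE /= !subE.
  apply: char_poly_restrictmx B2 _; first exact: row_base_free.
  by rewrite -/p1 -/p2 mulmxA eY -mulmxA eX mulmxA.
have nz : 'X^(\rank V2) != 0 :> {poly R} by rewrite expf_neq0 ?polyX_eq0.
apply: (mulfI nz); rewrite (char_poly_mulC X Y).
by congr (_ * _); rewrite rk.
Qed.

End Tuples.

(** * Regular linear tuples are reducible *)

Section Regular.
Context {R : realType} {n : nat}.
Implicit Types (k : nat) (T : linear_tuple R n).

(** Transversality is symmetric: it says that the pairing of the two subspaces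
    is perfect. *)
Lemma regular_linear_swap k T : regular_linear k T -> regular_linear k (swap T).
Proof.
case=> -[[sN su] r1 r2] [m1 m2 cap] rk tr od; split => //=.
- split => //; case: ifP cap => _; rewrite ?[(sub2 T :&: _)%MS]capmxC //.
  by rewrite [(sub2 T + _)%MS]addsmxC.
- case: ifP rk => _; rewrite ?[(sub2 T :&: _)%MS]capmxC //.
  by rewrite [(sub2 T + _)%MS]addsmxC.
- set U := sub1 T in r1 tr *; set V := sub2 T in r2 tr *; set s := lform T in sN su tr *.
  have rkS X : \rank (skew_orth s X) = (n.*2 - \rank X)%N.
    rewrite mxrank_ker -[in LHS]mxrank_tr trmx_mul trmxK mxrankMfree //.
    by rewrite row_free_unit unitmx_tr.
  have full (X Y : 'M[R]_n.*2) : \rank X = k -> \rank Y = k ->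
      row_full (skew_orth s X + Y)%MS = (\rank (Y *m s *m X^T) == k).
    move=> rX rY; have kn : (k <= n.*2)%N by rewrite -rX rank_leq_row.
    have := mxrank_sum_cap (skew_orth s X) Y; rewrite rkS rX rY.
    have := rank_cap_skew_orth s Y X; rewrite rY [(skew_orth s X :&: Y)%MS]capmxC.
    by move=> e1 e2; apply/eqP/eqP; lia.
  by rewrite full // rank_pairingC // -full.
- by move=> k_odd; have := od k_odd; rewrite /ker_plane /= addsmxC.
Qed.

(** The space that the reduced space is when k is even; for k odd it remains to
    cut it by the skew-orthogonal of the plane of kernels. *)
Definition ambient k T : 'M[R]_n.*2 :=
  if (k <= n)%N then (sub1 T + sub2 T)%MS
  else skew_orth (lform T) (sub1 T :&: sub2 T)%MS.

Lemma reduced_subE k T U : reduced_sub k T U =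
  if odd k then (U :&: ambient k T :&: skew_orth (lform T) (ker_plane T))%MS
  else (U :&: ambient k T)%MS.
Proof. by rewrite /reduced_sub /reduced_space; case: ifP; rewrite ?capmxA. Qed.

(** For k > n the intersection D of the two subspaces is nondegenerate, and
    [sub1 T] is the direct sum of D and of the part of [sub1 T] orthogonal
    to D, which therefore has the same kernel as [sub1 T]. *)
Lemma ambient_sub k T : regular_linear k T ->
  let V := (sub1 T :&: ambient k T)%MS in
  [/\ (ker_on (lform T) V <= ker_on (lform T) (sub1 T))%MS,
      (ker_on (lform T) (sub1 T) <= V)%MS
    & \rank V = if (k <= n)%N then k else (n.*2 - k)%N].
Proof.
case=> -[[sN _] r1 r2] [_ _ cap] rk _ _; rewrite /ambient.
set U := sub1 T in r1 cap rk *; set s := lform T in sN rk *.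
case: leqP cap rk => [le_kn|lt_nk] cap rk /=.
  have /capmx_idPl eV : (U <= U + sub2 T)%MS by apply: addsmxSl.
  split; rewrite ?eV // ?capmxSl //; apply: capmxS; first exact: capmxSl.
  by apply: skew_orthS; rewrite eV.
set D := (U :&: sub2 T)%MS in rk *; have DU : (D <= U)%MS := capmxSl _ _.
have rD : \rank D = (k - n).*2.
  have := mxrank_sum_cap U (sub2 T); rewrite -/D r1 r2; move/eqP: cap => ->.
  by lia.
have rUD : \rank (U *m s *m D^T) = \rank D.
  apply/eqP; rewrite eqn_leq -{1}(mxrank_tr D) mxrankM_maxr /=.
  by rewrite rD -rk /rank_on -!mulmxA mxrankS // submxMr.
split.
- apply: (ker_on_cap sN DU); first by rewrite rUD rD -rk.
  by apply/eqP; rewrite -sub_skew_orth capmxSr.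
- by rewrite sub_capmx capmxSl /=; apply: submx_trans (capmxSr _ _) (skew_orthS _ _).
- by have := rank_cap_skew_orth s U D; rewrite rUD rD r1; lia.
Qed.

Lemma rank_ker_on_odd k T : regular_linear k T -> odd k ->
  \rank (ker_on (lform T) (sub1 T)) = 1%N.
Proof.
case=> -[_ r1 _] [m1 _ _] _ _ _ k_odd.
have := rank_cap_skew_orth (lform T) (sub1 T) (sub1 T).
rewrite -/(ker_on _ _) -/(rank_on _ _) m1 r1 => e; have := odd_double_half k.
by rewrite k_odd; lia.
Qed.

(** For k odd let l1 and l2 be the kernels of the form on the two subspaces and
    P = l1 + l2.  On V = [sub1 T :&: ambient k T] the form has kernel l1, so
    that V pairs with P only through the line l2; as the form does not vanish
    on P, the line l1 already pairs with l2, and the orthogonal of P in V is a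
    complement of l1, on which the form is nondegenerate. *)
Lemma reduced_sub1 k T : regular_linear k T ->
  let V := reduced_sub k T (sub1 T) in
  ker_on (lform T) V = 0 /\
  \rank V = ((if (k <= n)%N then k else n.*2 - k) - odd k)%N.
Proof.
move=> regT; have [kerV kerU rV] := ambient_sub regT.
have [[[sN _] r1 _] [m1 _ _] _ _ od] := regT.
rewrite reduced_subE -rV; set V := (sub1 T :&: _)%MS in kerV kerU *.
set U := sub1 T in r1 m1 kerU kerV *; set s := lform T in sN m1 kerV kerU od *.
case: ifP => k_odd; last first.
  rewrite subn0; split=> //; apply/eqP; rewrite -submx0.
  rewrite (submx_trans kerV) // submx0; apply/eqP/(rank_on_nondeg s U).
  by rewrite m1 r1 -{2}(odd_double_half k) k_odd.
have rl1 : \rank (ker_on s U) = 1%N := rank_ker_on_odd regT k_odd.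
have rl2 : \rank (ker_on s (sub2 T)) = 1%N :=
  rank_ker_on_odd (regular_linear_swap regT) k_odd.
set l1 := ker_on s U in kerV kerU rl1 *; set l2 := ker_on s (sub2 T) in rl2 *.
have Ul1 : U *m s *m l1^T = 0.
  by apply: (orth_sym sN); apply/eqP; rewrite -sub_skew_orth capmxSr.
have Vl1 : V *m s *m l1^T = 0 := orth_sub (capmxSl _ _) (submx_refl _) Ul1.
have l11 : l1 *m s *m l1^T = 0 := orth_sub (capmxSl _ _) (submx_refl _) Ul1.
have Ul2 : sub2 T *m s *m l2^T = 0.
  by apply: (orth_sym sN); apply/eqP; rewrite -sub_skew_orth capmxSr.
have l22 : l2 *m s *m l2^T = 0 := orth_sub (capmxSl _ _) (submx_refl _) Ul2.
set P := ker_plane T; have PE : P = (l1 + l2)%MS by [].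
have leVP : (\rank (V *m s *m P^T) <= 1)%N.
  rewrite rank_pairingC // -mulmxA PE (eqmxMr _ (addsmxE _ _)) mul_col_mx mulmxA.
  rewrite (orth_sym sN Vl1) rank_col_0mx -rl2; exact: mxrankM_maxl.
have nzl1P : (0 < \rank (l1 *m s *m P^T))%N.
  rewrite lt0n mxrank_eq0; apply/eqP => l1P; apply: (od k_odd).
  have l12 : l1 *m s *m l2^T = 0.
    by apply: (orth_sub (submx_refl _) _ l1P); rewrite PE addsmxSr.
  rewrite -/P PE; apply: orthD => //; apply: orth_sym => //; apply: orthD => //.
  exact: orth_sym.
have lel1V : (\rank (l1 *m s *m P^T) <= \rank (V *m s *m P^T))%N.
  by rewrite -!mulmxA mxrankS // submxMr.
have el1 : \rank (l1 *m s *m P^T) = 1%N by lia.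
have eV : \rank (V *m s *m P^T) = 1%N by lia.
split; last by have := rank_cap_skew_orth s V P; rewrite eV; lia.
apply/eqP; rewrite -submx0.
have <- : (l1 :&: skew_orth s P)%MS = 0.
  apply/eqP; rewrite -mxrank_eq0.
  by have := rank_cap_skew_orth s l1 P; rewrite el1 rl1; lia.
rewrite sub_capmx (submx_trans (capmxSl _ _) (capmxSr _ _)) andbT.
apply: submx_trans kerV; apply: (ker_on_cap sN kerU); first by rewrite el1 eV.
exact: orth_sub (capmxSl _ _) (submx_refl _) Vl1.
Qed.

Lemma regular_reducible k T : regular_linear k T -> reducible k T.
Proof.
move=> regT; have [nd1 rk1] := reduced_sub1 regT.
have [] := reduced_sub1 (regular_linear_swap regT).
rewrite /reduced_sub reduced_space_swap -/(reduced_sub _ _ _) => nd2 rk2.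
by split=> //; rewrite rk1 -rk2.
Qed.

Lemma char_numbers_linear_invariant k T T' A :
  regular_linear k T -> regular_linear k T' ->
  isometric T T' A \/ isometric (swap T) T' A ->
  char_numbers_linear k T = char_numbers_linear k T'.
Proof.
move=> regT regT' iso; have redT' := regular_reducible regT'.
suff e : char_poly (char_operator k T) = char_poly (char_operator k T').
  by rewrite /char_numbers_linear e.
case: iso => iso; first exact: char_poly_operator_map (regular_reducible regT) _ iso.
rewrite -(char_poly_operator_swap (regular_reducible regT)).
exact: char_poly_operator_map (regular_reducible (regular_linear_swap regT)) _ iso.
Qed.

End Regular.

(** * Derivatives of curves and charts *)

Section Calculus.
Context {R : realType} {m : nat}.
Local Notation E := 'rV[R]_m.

Lemma class_at_differentiable (V W : normedModType R) c (f : V -> W) a :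
  class_at c f a -> differentiable f a.
Proof.
have smooth_diff : smooth_at f a -> differentiable f a.
  by move=> /nbhs_singleton /(_ [::]).
by case: c => [|[/smooth_diff]].
Qed.

Lemma mul_jacobian (f : E -> E) a u : u *m 'J f a = 'd f a u.
Proof. exact: mul_rV_lin1. Qed.

Lemma local_diffeo_jacobian_unit c (Phi : E -> E) :
  local_diffeo c Phi -> 'J Phi 0 \in unitmx.
Proof.
case=> Phi0 /class_at_differentiable dPhi.
case=> Psi [_ /class_at_differentiable dPsi PsiPhi _].
suff e : 'J Phi 0 *m 'J Psi 0 = 1%:M; first exact: (proj1 (mulmx1_unit e)).
apply/row_matrixP => i; rewrite !rowE mulmx1 mulmxA !mul_jacobian.
set u := delta_mx 0 i.
have dPsi' : differentiable Psi (Phi 0) by rewrite Phi0.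
have dcomp := congr1 (@^~ u) (diff_comp dPhi dPsi').
rewrite [in RHS]/= Phi0 in dcomp; rewrite -dcomp -deriveE; last first.
  exact: differentiable_comp.
by rewrite (near_eq_derive u PsiPhi) derive_id.
Qed.

(** The product of the difference quotients at 0 vanishes near 0, hence its limit
    is 0. *)
Lemma mul_eq0_near_deriv (f g : R -> R) : differentiable f 0 -> differentiable g 0 ->
  f 0 = 0 -> g 0 = 0 -> (\forall t \near (0 : R), f t * g t = 0) ->
  'D_1 f 0 * 'D_1 g 0 = 0.
Proof.
move=> df dg f0 g0 fg.
have quot (h : R -> R) : differentiable h 0 -> h 0 = 0 ->
    (fun t : R => t^-1 * h t) @ (0 : R)^' --> ('D_1 h 0 : R).
  move=> dh h0; have := @diff_derivable _ _ _ h 0 (1 : R) dh.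
  rewrite /derivable /derive (_ : (fun t => _) = (fun t : R => t^-1 * h t)) //.
  by apply/funext => t; rewrite /= h0 subr0 addr0 /GRing.scale /= mulr1.
have lim_fg := cvgM (quot f df f0) (quot g dg g0).
rewrite -(cvg_lim (@norm_hausdorff _ _) (lim_fg _)); apply: cvg_lim.
  exact: norm_hausdorff.
apply: (@cvg_trans _ ((fun=> 0 : R) @ (0 : R)^')); last exact: cvg_cst.
apply: near_eq_cvg; apply: nbhs_dnbhs; near=> h.
rewrite /= mulrACA (_ : f h * g h = 0) ?mulr0 //.
by near: h.
Unshelve. all: by end_near.
Qed.

Lemma mul_eq0_near_curve (gamma : R -> E) (F G : E -> R) :
  differentiable gamma 0 -> gamma 0 = 0 -> differentiable F 0 ->
  differentiable G 0 -> F 0 = 0 -> G 0 = 0 ->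
  (\forall t \near (0 : R), F (gamma t) * G (gamma t) = 0) ->
  'd F 0 ('D_1 gamma 0) * 'd G 0 ('D_1 gamma 0) = 0.
Proof.
move=> dgam gam0 dF dG F0 G0 FG.
have comp (H : E -> R) : differentiable H 0 ->
    differentiable (H \o gamma) 0 /\ 'd H 0 ('D_1 gamma 0) = 'D_1 (H \o gamma) 0.
  rewrite -gam0 => dH; have dc := differentiable_comp dgam dH.
  split=> //; rewrite (deriveE _ dgam) (deriveE _ dc).
  exact: (esym (congr1 (@^~ 1) (diff_comp dgam dH))).
have [dFg ->] := comp F dF; have [dGg ->] := comp G dG.
by apply: mul_eq0_near_deriv => //=; rewrite gam0.
Qed.

Lemma diff_coord (f : E -> E) a (i : 'I_m) : differentiable f a ->
  differentiable (fun x => f x 0 i : R) a /\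
  forall v, 'd (fun x => f x 0 i : R) a v = 'd f a v 0 i.
Proof.
move=> df; have @coord : {linear E -> R}.
  by exists (fun N : E => N 0 i); do 2![eexists]; do ?[constructor];
     rewrite ?mxE // => ? *; rewrite ?mxE //; move=> ?; rewrite !mxE.
have coord_cont : continuous coord.
  move=> x; exact: (differentiable_continuous (differentiable_coord x 0 i)).
split=> [|v]; first exact: differentiable_comp df (differentiable_coord _ 0 i).
rewrite (_ : (fun x => f x 0 i) = coord \o f) // diff_comp //.
  by rewrite diff_lin.
exact: linear_differentiable.
Qed.

(** The vectors on which all coordinates of index at least k of the differential
    of phi at 0 vanish: the tangent space at 0 of the preimage of R^k x {0}. *)
Definition straight_kernel k (phi : E -> E) : 'M[R]_m :=
  kermx ('J phi 0 *m copid_mx k).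

Lemma mul_copid_mx k (v : E) i :
  (v *m copid_mx k) 0 i = if (i < k)%N then 0 else v 0 i.
Proof.
rewrite mulmxBr mulmx1 [LHS]mxE [X in _ + X]mxE [X in _ - X]mxE (bigD1 i) //=.
rewrite big1 => [|j ji].
  by rewrite mxE eqxx /=; case: ifP => _; rewrite ?mulr1 ?mulr0 addr0 ?subrr ?subr0.
by rewrite mxE (_ : (j == i :> nat) = false) ?mulr0 //; apply/negbTE.
Qed.

Lemma sub_straight_kernel k phi (v : E) : (v <= straight_kernel k phi)%MS <->
  forall i : 'I_m, (k <= i)%N -> 'd phi 0 v 0 i = 0.
Proof.
rewrite /straight_kernel; split=> [|h].
  rewrite sub_kermx mulmxA mul_jacobian => /eqP/rowP h i ki.
  by have := h i; rewrite mul_copid_mx ltnNge ki mxE.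
rewrite sub_kermx mulmxA mul_jacobian; apply/eqP/rowP => i.
by rewrite mul_copid_mx mxE; case: ltnP => // /h.
Qed.

Lemma rank_straight_kernel c k phi : local_diffeo c phi -> (k <= m)%N ->
  \rank (straight_kernel k phi) = k.
Proof.
move=> /local_diffeo_jacobian_unit; rewrite -row_full_unit => u km.
by rewrite mxrank_ker eqmxMfull // rank_copid_mx // subKn.
Qed.

Lemma near_curve (gamma : R -> E) (P : E -> Prop) : differentiable gamma 0 ->
  gamma 0 = 0 -> (\forall x \near (0 : E), P x) ->
  \forall t \near (0 : R), P (gamma t).
Proof.
by move=> /differentiable_continuous gc g0 nearP; apply: (gc P); rewrite g0.
Qed.

(** A nonzero [tangent_space] is not the default value of the choice that
    defines it. *)
Lemma tangent_spaceP (S : set E) (v : E) : tangent_space S 0 != 0 ->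
  (v <= tangent_space S 0)%MS <-> tangent_vector S 0 v.
Proof.
rewrite /tangent_space; set P := [set U | _].
by case: xgetP => [U _ PU _|]; [exact: PU|rewrite eqxx].
Qed.

Lemma smooth_curve_differentiable (gamma : R -> E) : smooth_at gamma 0 ->
  differentiable gamma 0.
Proof. exact: (@class_at_differentiable _ _ Smooth). Qed.

(** The chain rule gives one inclusion, and the dimensions agree. *)
Lemma tangent_space_straight c k (S : set E) (phi : E -> E) :
  local_diffeo c phi ->
  (\forall x \near (0 : E),
     S x <-> forall i : 'I_m, (k <= i)%N -> phi x 0 i = 0) ->
  (0 < k)%N -> \rank (tangent_space S 0) = k ->
  (tangent_space S 0 :=: straight_kernel k phi)%MS.
Proof.
move=> dphi Sphi k0 rk; have km : (k <= m)%N by rewrite -rk rank_leq_row.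
have nz : tangent_space S 0 != 0 by rewrite -mxrank_eq0 rk -lt0n.
have sub : (tangent_space S 0 <= straight_kernel k phi)%MS.
  apply/rV_subP => v /(tangent_spaceP v nz)[gamma [smg g0 Sg <-]].
  have dg := smooth_curve_differentiable smg.
  case: (dphi) => phi0 /class_at_differentiable dphi0 _.
  apply/sub_straight_kernel => i ki; have [di diE] := diff_coord i dphi0.
  have := mul_eq0_near_curve dg g0 di di.
  rewrite phi0 !mxE diE => /(_ erefl erefl) h; apply/eqP.
  rewrite -[_ == 0]orbb -mulf_eq0; apply/eqP/h.
  have Sphig := near_curve dg g0 Sphi.
  by near=> t; rewrite (near Sphig t _).1 ?mulr0 //; near: t.
apply/eqmxP; rewrite sub /=.
by rewrite -(mxrank_leqif_sup sub).2 rk (rank_straight_kernel dphi km).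
Unshelve. all: by end_near.
Qed.

End Calculus.

(** * Germs *)

Section Union.
Variables (F : fieldType) (m n : nat).

Lemma sub_or_sub (U : 'M[F]_(m, n)) (K1 K2 : 'M[F]_n) :
  (forall u : 'rV[F]_n, (u <= U)%MS -> (u <= K1)%MS \/ (u <= K2)%MS) ->
  (U <= K1)%MS \/ (U <= K2)%MS.
Proof.
move=> UK; have [|/row_subPn[i ri]] := boolP (U <= K1)%MS; first by left.
have [|/row_subPn[j rj]] := boolP (U <= K2)%MS; first by right.
have ri2 : (row i U <= K2)%MS by case: (UK _ (row_sub i U)) ri => // ->.
have rj1 : (row j U <= K1)%MS by case: (UK _ (row_sub j U)) rj => // ->.
have [h|h] := UK _ (addmx_sub (row_sub i U) (row_sub j U)).
  by case/negP: ri; rewrite -[row i U](addrK (row j U)) addmx_sub // eqmx_opp.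
by case/negP: rj; rewrite -[row j U](addKr (row i U)) addmx_sub // eqmx_opp.
Qed.

End Union.

Section Germs.
Context {R : realType} {n : nat}.
Implicit Types T : germ_tuple R n.
Local Notation E := 'rV[R]_n.*2.

Lemma bilin_inj (m : nat) (s s' : 'M[R]_m) :
  (forall u v, bilin s u v = bilin s' u v) -> s = s'.
Proof.
move=> h; apply/matrixP => i j.
have bE (t : 'M[R]_m) : bilin t (delta_mx 0 i) (delta_mx 0 j) = t i j.
  by rewrite /bilin -rowE trmx_delta -colE !mxE.
by rewrite -!bE h.
Qed.

(** A diffeomorphism that maps S into the union of S' and S'' maps the tangent
    space of S at 0 onto that of S' or onto that of S'', if all three have the
    same positive dimension. *)
Lemma tangent_union c k (Phi : E -> E) (S S' S'' : set E) :
  local_diffeo c Phi -> (0 < k)%N ->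
  submanifold_germ c k S' -> submanifold_germ c k S'' ->
  \rank (tangent_space S 0) = k -> \rank (tangent_space S' 0) = k ->
  \rank (tangent_space S'' 0) = k ->
  (\forall x \near (0 : E), S x -> S' (Phi x) \/ S'' (Phi x)) ->
  (tangent_space S 0 *m 'J Phi 0 :=: tangent_space S' 0)%MS \/
  (tangent_space S 0 *m 'J Phi 0 :=: tangent_space S'' 0)%MS.
Proof.
move=> dPhi k0 [phi' dphi' S'E] [phi'' dphi'' S''E] rk rk' rk'' SS.
have eK' := tangent_space_straight dphi' S'E k0 rk'.
have eK'' := tangent_space_straight dphi'' S''E k0 rk''.
have uA := local_diffeo_jacobian_unit dPhi; set A := 'J Phi 0 in uA *.
have fA : row_free A by rewrite row_free_unit.
have nz : tangent_space S 0 != 0 by rewrite -mxrank_eq0 rk -lt0n.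
have eqS (K : 'M[R]_n.*2) : \rank K = k ->
    (tangent_space S 0 *m A <= K)%MS -> (tangent_space S 0 *m A :=: K)%MS.
  move=> rK sub; apply/eqmxP; rewrite sub /=.
  by rewrite -(mxrank_leqif_sup sub).2 mxrankMfree // rk rK.
suff [h|h] : (tangent_space S 0 *m A <= tangent_space S' 0)%MS \/
    (tangent_space S 0 *m A <= tangent_space S'' 0)%MS.
- by left; apply: eqS.
- by right; apply: eqS.
apply: sub_or_sub => u uU.
have : (u *m invmx A <= tangent_space S 0)%MS.
  by rewrite -(submxMfree _ _ fA) mulmxKV.
move=> /(tangent_spaceP _ nz)[gamma [smg g0 Sg vE]].
have uE : u = 'd Phi 0 ('D_1 gamma 0) by rewrite vE -mul_jacobian mulmxKV.
have dg := smooth_curve_differentiable smg.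
have [Phi0 /class_at_differentiable dPhi0 _] := dPhi.
have [p'0 /class_at_differentiable dp' _] := dphi'.
have [p''0 /class_at_differentiable dp'' _] := dphi''.
have comp (p : E -> E) (i : 'I_n.*2) : differentiable p 0 -> p 0 = 0 ->
    [/\ differentiable (fun x => p (Phi x) 0 i : R) 0,
        p (Phi 0) 0 i = 0
      & 'd (fun x => p (Phi x) 0 i : R) 0 ('D_1 gamma 0) = 'd p 0 u 0 i].
  move=> dp p0; have dp1 : differentiable p (Phi 0) by rewrite Phi0.
  have dc : differentiable (p \o Phi) 0 by apply: differentiable_comp.
  have [dF dFE] := diff_coord i dc.
  split; [exact: dF|by rewrite Phi0 p0 mxE|].
  rewrite dFE uE; set w := 'D_1 gamma 0.
  have e : 'd (p \o Phi) 0 w = 'd p (Phi 0) ('d Phi 0 w) :=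
    congr1 (@^~ w) (diff_comp dPhi0 dp1).
  by move: e; rewrite Phi0 => e; exact: (congr1 (fun v : E => v 0 i) e).
have prod0 (i j : 'I_n.*2) : (k <= i)%N -> (k <= j)%N ->
    'd phi' 0 u 0 i * 'd phi'' 0 u 0 j = 0.
  move=> ki kj; have [d1 z1 e1] := comp _ i dp' p'0.
  have [d2 z2 e2] := comp _ j dp'' p''0.
  apply: (eq_trans (esym (congr2 *%R e1 e2))).
  apply: (mul_eq0_near_curve dg g0 d1 d2 z1 z2).
  have SSg := near_curve dg g0 SS.
  have Phig : differentiable (Phi \o gamma) 0.
    by apply: differentiable_comp => //; rewrite g0.
  have Phig0 : (Phi \o gamma) 0 = 0 by rewrite /= g0.
  have S'g := near_curve Phig Phig0 S'E.
  have S''g := near_curve Phig Phig0 S''E.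
  near=> t.
  have St : S (gamma t) by near: t.
  have SSt : S (gamma t) -> S' (Phi (gamma t)) \/ S'' (Phi (gamma t)) by near: t.
  have [S't|S''t] := SSt St.
  - have S'Et : S' (Phi (gamma t)) -> forall l : 'I_n.*2, (k <= l)%N ->
        phi' (Phi (gamma t)) 0 l = 0.
      by near: t; apply: filterS S'g => t [].
    by rewrite (S'Et S't) ?mul0r.
  - have S''Et : S'' (Phi (gamma t)) -> forall l : 'I_n.*2, (k <= l)%N ->
        phi'' (Phi (gamma t)) 0 l = 0.
      by near: t; apply: filterS S''g => t [].
    by rewrite (S''Et S''t) ?mulr0.
rewrite eK' eK''.
(* Either all last coordinates for phi' vanish at u, or one of them is nonzero
   and then all those for phi'' vanish. *)
have [h|/existsNP[i /not_implyP[ki /eqP nzi]]] :=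
    pselect (forall i : 'I_n.*2, (k <= i)%N -> 'd phi' 0 u 0 i = 0).
  by left; apply/sub_straight_kernel.
right; apply/sub_straight_kernel => j kj.
by have /eqP := prod0 i j ki kj; rewrite mulf_eq0 (negbTE nzi) => /eqP.
Unshelve. all: by end_near.
Qed.

(** The linear part of an equivalence is an isometry of the linearizations, up
    to the exchange of the two subspaces. *)
Lemma equivalent_isometric c k T T' : (2 <= k)%N -> (k <= 2 * n - 2)%N ->
  regular c k T -> regular c k T' -> equivalent c T T' ->
  exists A, isometric (linearization T) (linearization T') A \/
            isometric (swap (linearization T)) (linearization T') A.
Proof.
move=> k2 kn [[_ [sub1T _] [sub2T _]] regT] [[_ [sub1T' _] [sub2T' _]] regT'].
case=> Phi [dPhi omegaPhi unionPhi]; exists ('J Phi 0).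
have uA := local_diffeo_jacobian_unit dPhi.
have isoA : 'J Phi 0 *m omega T' 0 *m ('J Phi 0)^T = omega T 0.
  apply: bilin_inj => u v; have [Phi0 _ _] := dPhi.
  have := nbhs_singleton omegaPhi u v; rewrite Phi0 -!mul_jacobian => <-.
  by rewrite /bilin trmx_mul !mulmxA.
have [[[_ /= r1 r2] [_ _ cap] _ _ _] [[_ /= r1' r2'] _ _ _ _]] := (regT, regT').
have k0 : (0 < k)%N by lia.
have union1 : \forall x \near (0 : E), S1 T x -> S1 T' (Phi x) \/ S2 T' (Phi x).
  by apply: filterS unionPhi => x [SS _] S1x; apply: SS; left.
have union2 : \forall x \near (0 : E), S2 T x -> S1 T' (Phi x) \/ S2 T' (Phi x).
  by apply: filterS unionPhi => x [SS _] S2x; apply: SS; right.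
have im1 := tangent_union dPhi k0 sub1T' sub2T' r1 r1' r2' union1.
have im2 := tangent_union dPhi k0 sub1T' sub2T' r2 r1' r2' union2.
set A := 'J Phi 0 in uA isoA im1 im2 *.
set U1 := tangent_space (S1 T) 0 in r1 cap im1 *.
set U2 := tangent_space (S2 T) 0 in r2 cap im2 *.
(* Both tangent spaces cannot have the same image, as they would be equal. *)
have neq (K : 'M[R]_n.*2) : (U1 *m A :=: K)%MS -> (U2 *m A :=: K)%MS -> False.
  move=> e1 e2; have fA : row_free A by rewrite row_free_unit.
  have U12 := eqmxMfree fA (eqmx_trans e1 (eqmx_sym e2)).
  case: leqP cap => [_ cap|lt_nk /eqP].
    suff : \rank U1 = 0 by rewrite r1; lia.
    by rewrite -(capmx_idPl _ : (U1 :&: U2 :=: U1)%MS) ?cap ?mxrank0 // U12.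
  have -> : (U1 + U2 :=: U1)%MS by apply/addsmx_idPl; rewrite U12.
  by rewrite r1; lia.
case: im1 im2 => [e1|e1] [e2|e2].
- by case: (neq _ e1 e2).
- by left.
- by right.
- by case: (neq _ e1 e2).
Qed.

End Germs.

Theorem theorem3p6 (R : realType) (c : category) (n k : nat)
    (hk2 : (2 <= k)%N) (hkn : (k <= 2 * n - 2)%N) (T T' : germ_tuple R n)
    (hT : regular c k T) (hT' : regular c k T') (hTT' : equivalent c T T') :
  perm_eq (char_numbers k T) (char_numbers k T').
Proof.
have [A isoA] := equivalent_isometric hk2 hkn hT hT' hTT'.
rewrite /char_numbers.
by rewrite (char_numbers_linear_invariant (proj2 hT) (proj2 hT') isoA).
Qed.
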